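(* Let $p$ be a prime, $R=\mathbb{F}_p[X,Y,Z,W]/(X^4+Y^4+Z^4+W^4)$, $I=(x,y,z)$ and $\mathfrak{m}=(I,w)$, where lower-case letters denote images of the variables. Then $I^*=\mathfrak{m}$ if $p=2$; $I^*=I+\mathfrak{m}^2$ if $p=3$; and $I^*=I+\mathfrak{m}^3$ if $p\geq5$.
   Context: $J^*$ denotes the tight closure: $x\in J^*$ iff there is $c$ not in any minimal prime of $R$ with $cx^q\in J^{[q]}$ for all large $q=p^e$, where $J^{[q]}$ is generated by $q$-th powers of generators of $J$. *)

(* Defs.v *)
From mathcomp Require Import all_boot all_algebra.
From mathcomp Require Import mpoly.

Set Implicit Arguments.
Unset Strict Implicit.
Unset Printing Implicit Defensive.

Import GRing.Theory.
Local Open Scope ring_scope.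

Section Ideals.
Variable A : comNzRingType.

Definition ideal_span (S : A -> Prop) : A -> Prop :=
  fun x => exists (n : nat) (a s : 'I_n -> A),
    (forall i, S (s i)) /\ x = \sum_(i < n) a i * s i.

Definition gen_ideal (s : seq A) : A -> Prop := ideal_span (fun x => x \in s).

Definition ideal_add (I J : A -> Prop) : A -> Prop :=
  ideal_span (fun x => I x \/ J x).

Definition ideal_mul (I J : A -> Prop) : A -> Prop :=
  ideal_span (fun x => exists a b, I a /\ J b /\ x = a * b).

Fixpoint ideal_pow (I : A -> Prop) (k : nat) : A -> Prop :=
  match k with
  | 0 => fun _ => True
  | k'.+1 => ideal_mul (ideal_pow I k') I
  end.

Definition frob_pow (gens : seq A) (q : nat) : A -> Prop :=
  gen_ideal [seq g ^+ q | g <- gens].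

Definition is_ideal (P : A -> Prop) : Prop :=
  [/\ P 0, (forall a b, P a -> P b -> P (a + b)) & (forall a b, P b -> P (a * b))].

Definition is_prime_ideal (P : A -> Prop) : Prop :=
  [/\ is_ideal P, ~ P 1 & (forall a b, P (a * b) -> P a \/ P b)].

(* P is a minimal prime over (f), i.e. (via the correspondence theorem)
   P/(f) is a minimal prime of A/(f). *)
Definition minimal_prime_over (f : A) (P : A -> Prop) : Prop :=
  [/\ is_prime_ideal P, P f &
      forall Q, is_prime_ideal Q -> Q f -> (forall x, Q x -> P x) ->
        forall x, P x -> Q x].

(* Tight closure in R = A/(f) (char p) of the ideal J = (gens)R, expressed
   on representatives u in A: u mod f lies in J^* iff there is c in A whose
   image in R avoids every minimal prime of R, with c u^q in J^[q] + (f)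
   for all q = p^e, e large. *)
Definition tight_closure_quot (p : nat) (f : A) (gens : seq A) (u : A) : Prop :=
  exists c : A,
    (forall P, minimal_prime_over f P -> ~ P c) /\
    exists N : nat, forall e : nat, (N <= e)%N ->
      ideal_add (frob_pow gens (p ^ e)) (gen_ideal [:: f]) (c * u ^+ (p ^ e)).

End Ideals.

Unset Implicit Arguments.

Definition Pring (p : nat) := {mpoly 'F_p[4]}.

Definition vX (p : nat) : Pring p := 'X_(inord 0).
Definition vY (p : nat) : Pring p := 'X_(inord 1).
Definition vZ (p : nat) : Pring p := 'X_(inord 2).
Definition vW (p : nat) : Pring p := 'X_(inord 3).

Definition fermat4 (p : nat) : Pring p :=
  vX p ^+ 4 + vY p ^+ 4 + vZ p ^+ 4 + vW p ^+ 4.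

Definition I_gens (p : nat) : seq (Pring p) := [:: vX p; vY p; vZ p].
Definition m_gens (p : nat) : seq (Pring p) := [:: vX p; vY p; vZ p; vW p].

Definition fI (p : nat) := gen_ideal [:: fermat4 p].
Definition IA (p : nat) := gen_ideal (I_gens p).
Definition mA (p : nat) := gen_ideal (m_gens p).

Definition Istar (p : nat) : Pring p -> Prop :=
  tight_closure_quot p (fermat4 p) (I_gens p).

(* Main.v *)
(* Put k = 1, 2, 3 for p = 2, p = 3, p >= 5; modulo f the claimed closure is
   I + (w^k), because w^4 lies in I + (f).

   For w^k in I^*: if p is 2 or 3, raising w^4 = -(x^4 + y^4 + z^4) to the power q/p^j
   puts w^(kq) in I^[q]. In general x w^(3q) lies in I^[q], since rewriting the
   fourth powers of w yields monomials of degree at least 3q - 2 in x, y, z.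

   Conversely an element of I^* outside I + (w^k) would, after multiplication by
   a power of w, give c w^((k-1)q) in I^[q] for large q with c nonzero in R.
   As R is free over B = F_p[x,y,z] on 1, w, w^2, w^3, a further factor of w reduces this
   to h g^N in (x^q, y^q, z^q) B with h nonzero and g = x^4 + y^4 + z^4. Splitting
   off the top digits of N in base p exhibits a monomial of h g^N whose exponents
   are all less than q. *)
Require Import Defs.
From mathcomp Require Import all_boot all_algebra.
From mathcomp Require Import mpoly.
From mathcomp Require Import ring zify.
From mathcomp Require boolp classical_sets.

Set Implicit Arguments.
Unset Strict Implicit.
Unset Printing Implicit Defensive.

Import GRing.Theory.
Local Open Scope ring_scope.

(** * Minimal primes over (f) avoiding a multiplicative set *)

Section MinimalPrimes.
Variables (A : comNzRingType) (f : A).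

Let multiple (x : A) := exists r, x = r * f.

(** Zorn gives a maximal multiplicative set [T] whose products with [S] miss (f); its complement is
    the required prime. *)
Lemma minimal_prime_avoiding (S : A -> Prop) :
  S 1 -> (forall a b, S a -> S b -> S (a * b)) ->
  (forall s, S s -> ~ multiple s) ->
  exists2 P, minimal_prime_over f P & forall s, S s -> ~ P s.
Proof.
move=> S1 SM Sf.
pose good (X : A -> Prop) := (forall x y, X x -> X y -> X (x * y)) /\
  (forall x s, X x -> S s -> ~ multiple (s * x)).
have [|T [[TM Tf] Tmax]] := @classical_sets.Zorn_bigcup A good.
  move=> F Fgood Ftot; split=> [x y [X FX Xx] [Y FY Yy]|x s [X FX Xx]]; last first.
    exact: (Fgood _ FX).2.
  have [XY|YX] := Ftot _ _ FX FY.
    by exists Y => //; apply: (Fgood _ FY).1 => //; apply: XY.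
  by exists X => //; apply: (Fgood _ FX).1 => //; apply: YX.
(* The multiplicative set generated by S, T and y; T need not contain 1, since
   the empty chain makes the empty set admissible. *)
pose U y x := exists s t n, [/\ S s, T t \/ t = 1 & x = s * t * y ^+ n].
have UM y a b : U y a -> U y b -> U y (a * b).
  move=> [s [t [n [Ss Tt ->]]]] [s' [t' [n' [Ss' Tt' ->]]]].
  exists (s * s'), (t * t'), (n + n')%N; split; first exact: SM.
    case: Tt => [Tt|->]; case: Tt' => [Tt'|->]; rewrite ?mulr1 ?mul1r; last by right.
    - by left; apply: TM.
    - by left.
    - by left.
  by rewrite exprD mulrACA (mulrACA s).
have TU y x : T x -> U y x.
  by move=> Tx; exists 1, x, 0%N; rewrite mul1r mulr1; split=> //; left.
have UT y : good (U y) -> forall x, U y x -> T x.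
  move=> gU x Ux; apply: boolp.contrapT => nTx.
  apply: (Tmax (U y)) gU; split; first exact: TU.
  by move=> /(_ x Ux).
have nT1 s t : S s -> T t \/ t = 1 -> ~ multiple (s * t).
  by move=> Ss [Tt|->]; [apply: Tf | rewrite mulr1; apply: Sf].
have ST s : S s -> T s.
  move=> Ss; apply: (UT 1); last first.
    by exists s, 1, 0%N; split=> //; [right | rewrite !mulr1].
  split; first exact: UM.
  move=> x s' [s1 [t [n [Ss1 Tt ->]]]] Ss'.
  by rewrite expr1n mulr1 mulrA; apply: nT1 => //; apply: SM.
have T1 : T 1 by apply: ST.
have Tnf x : T x -> ~ multiple x by move=> Tx; rewrite -[x]mul1r; apply: Tf.
have TX x n : T x -> T (x ^+ n).
  by move=> Tx; elim: n => [|n IH] //; rewrite exprS; apply: TM.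
(* Maximality in usable form: [y] is outside [T] exactly when adjoining it produces a multiple of
   [f]. The ideal axioms and minimality both rest on this. *)
have nTP y : ~ T y <-> exists t n, T t /\ multiple (t * y ^+ n).
  split; last first.
    by move=> [t [n [Tt ft]]] Ty; apply: (Tnf _ _ ft); apply: TM => //; apply: TX.
  move=> nTy; apply: boolp.contrapT => H; apply: nTy; apply: (UT y); last first.
    by exists 1, 1, 1%N; rewrite !mul1r; split=> //; right.
  split; first exact: UM.
  move=> x s' [s1 [t [n [Ss1 Tt ->]]]] Ss' mx; apply: H.
  exists (s' * (s1 * t)), n; split; last by rewrite -mulrA.
  apply: (TM); first exact: ST.
  by case: Tt => [Tt|->]; [apply: TM => //; apply: ST | rewrite mulr1; apply: ST].
have mD x y : multiple x -> multiple y -> multiple (x + y).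
  by move=> [r ->] [s ->]; exists (r + s); rewrite mulrDl.
have mM x y : multiple y -> multiple (x * y).
  by move=> [r ->]; exists (x * r); rewrite mulrA.
have Pid : is_ideal (fun x => ~ T x).
  split.
  - by apply/nTP; exists 1, 1%N; split=> //; exists 0; rewrite mul0r mulr0.
  - move=> a b /nTP[s [n [Ts fs]]] /nTP[t [m [Tt ft]]]; apply/nTP.
    exists (s * t), (n + m)%N; split; first exact: TM.
    (* Every term of (a + b)^(n+m) contains a^n or b^m. *)
    rewrite exprDn mulr_sumr; apply: big_ind => //; first by exists 0; rewrite mul0r.
    move=> [i /=]; rewrite ltnS => lei _; rewrite -mulr_natl [s * t * _]mulrCA; apply: (mM).
    have [lemi|ltim] := leqP m i.
      have -> : s * t * (a ^+ (n + m - i) * b ^+ i) =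
                s * a ^+ (n + m - i) * b ^+ (i - m) * (t * b ^+ m).
        have -> : b ^+ i = b ^+ (i - m) * b ^+ m by rewrite -exprD subnK.
        by ring.
      exact: mM.
    have -> : s * t * (a ^+ (n + m - i) * b ^+ i) =
              t * a ^+ (m - i) * b ^+ i * (s * a ^+ n).
      have -> : a ^+ (n + m - i) = a ^+ n * a ^+ (m - i) by rewrite -exprD addnBA 1?ltnW.
      by ring.
    exact: mM.
  - move=> a b /nTP[t [n [Tt ft]]]; apply/nTP; exists t, n; split=> //.
    by rewrite exprMn mulrCA; apply: (mM).
exists (fun x => ~ T x); last by move=> s /ST Ts; apply.
split.
- split=> [||a b nTab]; [exact: Pid | by apply | ].
  apply: boolp.contrapT => /boolp.not_orP[/boolp.contrapT Ta /boolp.contrapT Tb].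
  by apply: nTab; apply: TM.
- by apply/nTP; exists 1, 1%N; split=> //; exists 1; rewrite mul1r.
(* [t] lies in [T], hence outside the smaller prime [Q], so [t * x ^+ n] in [Q] forces [x] into
   [Q]. *)
- move=> Q [[Q0 QD QM] Q1 Qpr] Qf QP x /nTP[t [n [Tt [r e]]]].
  have Qtx : Q (t * x ^+ n) by rewrite e; apply: QM.
  case: (Qpr _ _ Qtx) => [/QP //|].
  elim: n {e Qtx} => [|n IH]; first by move/Q1.
  by rewrite exprS => /Qpr[].
Qed.

End MinimalPrimes.

(** * Singling out the last variable of a multivariate polynomial *)

Lemma mpoly_ring_ind n (R : nzRingType) (P : {mpoly R[n]} -> Prop) :
  (forall c, P c%:MP) -> (forall i, P 'X_i) ->
  (forall u v, P u -> P v -> P (u + v)) ->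
  (forall u v, P u -> P v -> P (u * v)) -> forall u, P u.
Proof.
move=> PC PX PD PM; elim/mpolyind => [|c m u _ _ Pu]; first by rewrite -mpolyC0.
apply: (PD) => //; rewrite -mul_mpolyC; apply: (PM) => //.
rewrite mpolyXE_id; have P1 : P 1 by rewrite -mpolyC1.
apply: (big_ind P) => [//|x y|i _]; first exact: PM.
by elim: (m i) => [|k IH]; rewrite ?expr0 // exprS; apply: (PM).
Qed.

Section Muni.
Variables (n : nat) (R : comNzRingType).

Lemma muni_last : muni ('X_ord_max : {mpoly R[n.+1]}) = 'X.
Proof.
rewrite muniE msuppX big_seq1 mcoeffX eqxx scale1r mnm1E eqxx expr1.
rewrite (_ : [multinom _ | _ < n] = 0%MM) ?mpolyX0 ?scale1r //.
by apply/mnmP=> j; rewrite mnmE mnm1E mnm0E eqE /= gtn_eqF.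
Qed.

Lemma muni_widen (i : 'I_n) :
  muni ('X_(widen_ord (leqnSn n) i) : {mpoly R[n.+1]}) = ('X_i)%:P.
Proof.
rewrite muniE msuppX big_seq1 mcoeffX eqxx scale1r mnm1E eqE /= ltn_eqF //.
rewrite expr0 alg_polyC; congr (_%:P); congr ('X_[_]).
by apply/mnmP=> j; rewrite mnmE !mnm1E.
Qed.

(** Substituting the last variable back inverts [muni]. Both maps respect sums and products, so
    constants and variables suffice. This lets divisibility be pulled back from univariate
    polynomials. *)
Lemma mwidenK_muni (u : {mpoly R[n.+1]}) : (map_poly (@mwiden n R) (muni u)).['X_ord_max] = u.
Proof.
elim/mpoly_ring_ind: u => [c|i|u v IHu IHv|u v IHu IHv].
- by rewrite muniC map_polyC hornerC /= mwidenC.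
- have [[j ->]|->] : (exists j, i = widen_ord (leqnSn n) j) \/ i = ord_max.
  + have := ltn_ord i; rewrite ltnS leq_eqVlt => /orP[/eqP ei|lti].
      by right; apply: val_inj.
    by left; exists (Ordinal lti); apply: val_inj.
  + rewrite muni_widen map_polyC hornerC /= mwidenX mnmwiden1.
    by congr ('X_[U_(_)]); apply: val_inj.
  + by rewrite muni_last map_polyX hornerX.
- have -> : muni (u + v) = muni u + muni v by apply: muniD.
  move: (muni u) (muni v) IHu IHv => a b <- <-.
  by rewrite rmorphD hornerD.
- have -> : muni (u * v) = muni u * muni v by apply: muniM.
  move: (muni u) (muni v) IHu IHv => a b <- <-.
  by rewrite rmorphM hornerM.
Qed.

Lemma muni_multiple (u v : {mpoly R[n.+1]}) r :
  muni u = r * muni v -> exists s, u = s * v.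
Proof.
move=> e; exists (map_poly (@mwiden n R) r).['X_ord_max].
move: (mwidenK_muni u) (mwidenK_muni v); rewrite e.
by move: (muni v) => b <- <-; rewrite rmorphM hornerM.
Qed.
End Muni.

(** * Additivity of Frobenius and generated ideals *)

Lemma exprD_pcharX (R : comNzRingType) p e (x y : R) :
  p \in [pchar R] -> (x + y) ^+ (p ^ e) = x ^+ (p ^ e) + y ^+ (p ^ e).
Proof.
move=> pR; apply: exprDn_pchar.
by rewrite (eq_pnat _ (pcharf_eq pR)) pnatX pnat_id ?(pcharf_prime pR).
Qed.

Section Ideals.
Variable A : comNzRingType.

Lemma ideal_span_min (S P : A -> Prop) :
  is_ideal P -> (forall x, S x -> P x) -> forall x, ideal_span S x -> P x.
Proof.
move=> [P0 PD PM] SP x [n [a [s [Ss ->]]]].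
by apply: big_ind => // i _; apply/PM/SP.
Qed.

Lemma mem_ideal_span (S : A -> Prop) x : S x -> ideal_span S x.
Proof.
by move=> Sx; exists 1%N, (fun=> 1), (fun=> x); rewrite big_ord1 mul1r.
Qed.

Lemma ideal_span_ideal (S : A -> Prop) : is_ideal (ideal_span S).
Proof.
split.
- by exists 0%N, (fun=> 0), (fun=> 0); rewrite big_ord0; split=> // -[].
- move=> x y [n [a [s [Ss ->]]]] [m [b [t [St ->]]]].
  pose glue (u : 'I_n -> A) (v : 'I_m -> A) i :=
    match split i with inl j => u j | inr j => v j end.
  exists (n + m)%N, (glue a b), (glue s t); split.
    by move=> i; rewrite /glue; case: split.
  rewrite big_split_ord /glue; congr (_ + _); apply: eq_bigr => i _.
    by rewrite (unsplitK (inl i)).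
  by rewrite (unsplitK (inr i)).
- move=> x y [n [a [s [Ss ->]]]]; exists n, (fun i => x * a i), s; split=> //.
  by rewrite mulr_sumr; apply: eq_bigr => i _; rewrite mulrA.
Qed.

(** Since Frobenius is additive, membership of p^e-th powers in an ideal can be tested on
    generators. *)
Lemma frob_preim_ideal (P : A -> Prop) p e :
  p \in [pchar A] -> is_ideal P -> is_ideal (fun u => P (u ^+ (p ^ e))).
Proof.
move=> pA [P0 PD PM]; split.
- by rewrite expr0n expn_eq0 -leqn0 leqNgt prime_gt0 ?(pcharf_prime pA).
- by move=> a b fa fb; rewrite (exprD_pcharX _ _ _ pA); apply: PD.
- by move=> a b fb; rewrite exprMn; apply: PM.
Qed.
End Ideals.

(** * Monomials of h g^N in three variables *)

Section FermatCurve.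
Variables (F : fieldType) (p : nat).
Hypothesis pF : p \in [pchar F].
Local Notation B := {mpoly F[3]}.

(** All exponents of [m] and of the terms of [h] are below [N], so dividing exponents by [N]
    recovers the shift: distinct shifts never meet. *)
Lemma mcoeffM_XE n (h : {mpoly F[n]}) N m s t :
  (msize h <= N)%N -> (mdeg m < N)%N ->
  (h * 'X_[s *+ N])@_(m + t *+ N) = if s == t then h@_m else 0.
Proof.
move=> hN mN; have [->|nst] := eqVneq s t.
  by rewrite addmC mcoeffMX.
apply/eqP; rewrite mcoeff_eq0 (perm_mem (msuppMX _ _)); apply/mapP => -[m' m'h e].
have m'N : (mdeg m' < N)%N by apply: leq_trans hN; apply: msize_mdeg_lt.
have N0 : (0 < N)%N by apply: leq_trans mN.
have lemd (m0 : 'X_{1..n}) i : (m0 i <= mdeg m0)%N.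
  by rewrite mdegE (bigD1 i) //= leq_addr.
case/eqP: nst; apply/mnmP => i; move/mnmP/(_ i): e.
rewrite !mnmDE !mulmnE addnC => /(congr1 (fun k => k %/ N)%N).
rewrite !divnMDl // !(@divn_small _ N) ?addn0 => [->||] //.
  by apply: leq_ltn_trans m'N.
by apply: leq_ltn_trans mN.
Qed.

Definition var (i : nat) : B := 'X_(inord i).
Definition mono (a b c : nat) : 'X_{1..3} :=
  (U_(inord 0) *+ a + U_(inord 1) *+ b + U_(inord 2) *+ c)%MM.

Lemma monoE a b c i : mono a b c i = nth 0%N [:: a; b; c] i.
Proof.
rewrite !mnmDE !mulmnE !mnm1E !eqE /= !inordK //.
by case: i => -[|[|[|]]] //= _; rewrite ?muln0 ?mul1n ?mul0n ?addn0 ?add0n.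
Qed.

Lemma monoX a b c : 'X_[mono a b c] = var 0 ^+ a * var 1 ^+ b * var 2 ^+ c.
Proof. by rewrite /mono !mpolyXD -!mpolyXn. Qed.

Lemma monoMn a b c N : (mono a b c *+ N)%MM = mono (a * N) (b * N) (c * N).
Proof. by apply/mnmP=> i; rewrite mulmnE !monoE; case: i => -[|[|[|]]]. Qed.

Lemma mono_eq a b c a' b' c' :
  (mono a b c == mono a' b' c') = [&& a == a', b == b' & c == c'].
Proof.
apply/eqP/and3P => [/mnmP e|[/eqP-> /eqP-> /eqP->] //].
have := (e (inord 0), e (inord 1), e (inord 2)).
by rewrite !monoE !inordK //= => -[[-> ->] ->].
Qed.

Definition frob_span (q : nat) (h : B) :=
  exists a b c, h = a * var 0 ^+ q + b * var 1 ^+ q + c * var 2 ^+ q.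

Lemma mcoeff_frob_span q (h : B) (m : 'X_{1..3}) :
  frob_span q h -> (forall i, m i < q)%N -> h@_m = 0.
Proof.
move=> [a [b [c ->]]] mq.
have E u i : (u * var i ^+ q)@_m = 0.
  apply/eqP; rewrite /var mpolyXn mcoeff_eq0 (perm_mem (msuppMX _ _)).
  apply/mapP => -[m' _ e]; have := mq (inord i).
  by rewrite e mnmDE mulmnE mnm1E eqxx; lia.
by rewrite !mcoeffD !E !addr0.
Qed.

Definition quartic : B := var 0 ^+ 4 + var 1 ^+ 4 + var 2 ^+ 4.

(* Writing exponents in base 4Q, the digit triple (a, b, c) singles out one term of
   the trinomial power, so no cancellation can occur at the monomial it shifts from h;
   that monomial has all its exponents below P Q. *)
Lemma frob_span_balanced (h : B) Q M P a b c :
  h != 0 -> (msize h <= 3 * Q)%N -> (a + b + c = M)%N ->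
  ('C(M, c) * 'C(M - c, b))%:R != 0 :> F ->
  (4 * a + 3 <= P)%N -> (4 * b + 3 <= P)%N -> (4 * c + 3 <= P)%N ->
  ~ frob_span (P * Q)
      (h * (var 0 ^+ (4 * Q) + var 1 ^+ (4 * Q) + var 2 ^+ (4 * Q)) ^+ M).
Proof.
move=> h0 hQ abc C0 aP bP cP span.
have [m mh] : exists m, m \in msupp h.
  have : msupp h != [::] by rewrite msupp_eq0.
  by case: msupp => // m s _; exists m; rewrite mem_head.
have mQ : (mdeg m < 3 * Q)%N by apply: leq_trans hQ; apply: msize_mdeg_lt.
have lemd i : (m i <= mdeg m)%N by rewrite mdegE (bigD1 i) //= leq_addr.
have := mcoeff_frob_span (m := (m + mono a b c *+ (4 * Q))%MM) span.
have imp (X Y : Prop) : X -> ~ Y -> (X -> Y) -> False by tauto.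
apply: imp.
(* Each exponent of [m] is below 3Q, which the 3 in [4 * a + 3 <= P] pays for: 4aQ + 3Q <= PQ. *)
- move=> i; rewrite mnmDE mulmnE monoE; have := lemd i.
  by case: i => -[|[|[|]]] //= lti; nia.
have E i j k : (h * (var 0 ^+ (4 * Q) ^+ i * var 1 ^+ (4 * Q) ^+ j *
    var 2 ^+ (4 * Q) ^+ k))@_(m + mono a b c *+ (4 * Q)) =
    if [&& i == a, j == b & k == c] then h@_m else 0.
  rewrite -!exprM ![(4 * Q * _)%N]mulnC -monoX -monoMn mcoeffM_XE ?mono_eq //; lia.
have cM : (c < M.+1)%N by lia.
have bM : (b < (M - c).+1)%N by lia.
have term (i j : nat) :
    (h * (var 0 ^+ (4 * Q) ^+ (M - i - j) * var 1 ^+ (4 * Q) ^+ j *+ 'C(M - i, j)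
      * var 2 ^+ (4 * Q) ^+ i *+ 'C(M, i)))@_(m + mono a b c *+ (4 * Q)) =
    if [&& (M - i - j)%N == a, j == b & i == c] then h@_m *+ ('C(M, i) * 'C(M - i, j))
    else 0.
  rewrite mulrnAl -mulrnA [('C(_, j) * _)%N]mulnC mulrnAr mcoeffMn E.
  by case: ifP; rewrite ?mul0rn.
(* Two binomial expansions: the outer index is the exponent of z, the inner one that of y. Only the
   pair (c, b) survives, weighted by the multinomial coefficient. *)
rewrite exprDn mulr_sumr raddf_sum /= (bigD1 (Ordinal cM)) //= [X in _ + X]big1 ?addr0.
  rewrite exprDn mulr_suml -sumrMnl mulr_sumr raddf_sum /=.
  rewrite (bigD1 (Ordinal bM)) //= [X in _ + X]big1 ?addr0 => [|j jb]; rewrite term.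
    rewrite ifT; last by lia.
    by apply/eqP; rewrite -mulr_natr mulf_neq0 // -mcoeff_msupp.
  by rewrite (_ : (_ == b) = false) ?andbF //; apply/negbTE.
move=> i ic; rewrite exprDn mulr_suml -sumrMnl mulr_sumr raddf_sum /= big1 // => j _.
by rewrite term (_ : (_ == c) = false) ?andbF //; apply/negbTE.
Qed.

Lemma quartic_neq0 : quartic != 0.
Proof.
apply/eqP => /(congr1 (mcoeff (mono 4 0 0))).
rewrite mcoeff0 /quartic -(mul1r (var 0 ^+ 4)).
have -> : 1 * var 0 ^+ 4 + var 1 ^+ 4 + var 2 ^+ 4 =
  'X_[mono 4 0 0] + 'X_[mono 0 4 0] + 'X_[mono 0 0 4].
  by rewrite !monoX !expr0 !mulr1 !mul1r.
rewrite !mcoeffD !mcoeffX !mono_eq /= !addr0 => /eqP; exact/negP/oner_neq0.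
Qed.

Lemma msize_quarticX n : (msize (quartic ^+ n) <= 4 * n + 1)%N.
Proof.
elim: n => [|n IH]; first by rewrite expr0 msize1.
rewrite exprS msizeM ?expf_neq0 ?quartic_neq0 //.
have q5 : (msize quartic <= 5)%N.
  have X4 i : (msize (var i ^+ 4) <= 5)%N by rewrite mpolyXn msizeX mdegMn mdeg1.
  rewrite (leq_trans (msizeD_le _ _)) // geq_max X4 andbT.
  by rewrite (leq_trans (msizeD_le _ _)) // geq_max !X4.
rewrite -subn1 leq_subLR (leq_trans (leq_add q5 IH)) //; lia.
Qed.

(** Frobenius turns g^(M p^e) into the M-th power of x^(4Q) + y^(4Q) + z^(4Q) with Q = p^e, while
    g^n is absorbed into [h]. *)
Lemma frob_span_quartic (h : B) e M P n a b c :
  h != 0 -> (msize h + 4 * n <= 3 * p ^ e)%N -> (a + b + c = M)%N ->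
  ('C(M, c) * 'C(M - c, b))%:R != 0 :> F ->
  (4 * a + 3 <= P)%N -> (4 * b + 3 <= P)%N -> (4 * c + 3 <= P)%N ->
  ~ frob_span (P * p ^ e) (h * quartic ^+ (M * p ^ e + n)).
Proof.
move=> h0 hQ abc C0 aP bP cP.
have pB : p \in [pchar B] by apply: (rmorph_pchar (@mpolyC 3 F)).
rewrite addnC exprD [(M * _)%N]mulnC exprM mulrA {2}/quartic !exprD_pcharX //.
rewrite -!exprM; apply: frob_span_balanced abc C0 aP bP cP.
  by rewrite mulf_neq0 // expf_neq0 // quartic_neq0.
rewrite msizeM ?expf_neq0 ?quartic_neq0 // -subn1 leq_subLR.
by rewrite (leq_trans (leq_add (leqnn _) (msize_quarticX n))) // addnA addnC leq_add2l.
Qed.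

End FermatCurve.

(** * R as a free module over B *)

Section Quartic.
Variable p : nat.
Hypothesis pp : prime p.
Local Notation A := (Pring p).
Local Notation x := (vX p).
Local Notation y := (vY p).
Local Notation z := (vZ p).
Local Notation w := (vW p).
Local Notation f := (fermat4 p).
Local Notation g := (quartic 'F_p).
Local Notation var := (var 'F_p).
Local Opaque muni.

Lemma pchar_Pring : p \in [pchar A].
Proof. exact: (rmorph_pchar (@mpolyC 4 'F_p)) (pchar_Fp pp). Qed.

Lemma muni_var (i : nat) : (i < 3)%N -> muni ('X_(inord i) : A) = (var i)%:P.
Proof.
move=> i3; rewrite -muni_widen; congr (muni 'X_[U_(_)]); apply: val_inj => /=.
by rewrite !inordK // ltnS ltnW.
Qed.

Lemma muni_vW : muni w = 'X.
Proof.
rewrite -(@muni_last 3 'F_p); congr (muni 'X_[U_(_)]); apply: val_inj => /=.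
by rewrite inordK.
Qed.

Let D : {poly {mpoly 'F_p[3]}} := 'X^4 + g%:P.

Lemma muni_quartic : muni (x ^+ 4 + y ^+ 4 + z ^+ 4) = g%:P.
Proof.
have X4 i : (i < 3)%N -> muni ('X_(inord i) ^+ 4 : A) = (var i ^+ 4)%:P.
  by move=> i3; rewrite rmorphXn /= muni_var // polyC_exp.
rewrite (muniD (x ^+ 4 + y ^+ 4)) (muniD (x ^+ 4)) /quartic.
rewrite (polyCD (var 0 ^+ 4 + var 1 ^+ 4)) (polyCD (var 0 ^+ 4)).
by congr (_ + _ + _); apply: X4.
Qed.

Lemma muni_fermat4 : muni (fermat4 p) = D.
Proof.
rewrite /fermat4 (muniD (x ^+ 4 + y ^+ 4 + z ^+ 4)) muni_quartic addrC.
by congr (_ + _); rewrite rmorphXn /= muni_vW.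
Qed.

Let Dmonic : D \is monic.
Proof. by rewrite /D -[g]opprK polyCN monicXnsubC. Qed.

Let sizeD : size D = 5.
Proof. by rewrite /D -[g]opprK polyCN size_XnsubC. Qed.

Import Pdiv.Ring Pdiv.RingMonic.

(** Coordinates of the class of [u] in the B-basis 1, w, w^2, w^3 of R, read off the remainder
    modulo the monic [D], the image of [f]. *)
Definition coord (i : nat) (u : A) : {mpoly 'F_p[3]} := (rmodp (muni u) D)`_i.

Lemma coordD i u v : coord i (u + v) = coord i u + coord i v.
Proof. by rewrite /coord muniD rmodpD // coefD. Qed.

Lemma coordM i u v b : muni v = b%:P -> coord i (u * v) = coord i u * b.
Proof.
by move=> vb; rewrite /coord muniM vb mulrC mul_polyC rmodpZ // coefZ mulrC.
Qed.

Lemma coordM_fermat4 i u : coord i (u * f) = 0.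
Proof. by rewrite /coord muniM muni_fermat4 rmodp_mull // coef0. Qed.

Lemma coord_eq0 u : (forall i, coord i u = 0) -> exists r, u = r * f.
Proof.
move=> u0; have r0 : rmodp (muni u) D = 0 by apply/polyP => i; rewrite coef0; apply: u0.
apply: (@muni_multiple _ _ u f (rdivp (muni u) D)).
by rewrite {1}(rdivp_eq Dmonic (muni u)) r0 addr0 muni_fermat4.
Qed.

Lemma coord_neq0 u : (~ exists r, u = r * f) -> exists i, coord i u != 0.
Proof.
move=> nu; apply: boolp.contrapT => H; apply/nu/coord_eq0 => i.
by apply: boolp.contrapT => ui; apply: H; exists i; apply/eqP.
Qed.

Lemma coordMW i u n : coord i (u * w ^+ (4 * n)) = coord i u * (- g) ^+ n.
Proof.
elim: n => [|n IH]; first by rewrite !mulr1.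
rewrite mulnS addnC exprD mulrA.
have -> : w ^+ 4 = - (x ^+ 4 + y ^+ 4 + z ^+ 4) + f by rewrite /fermat4; ring.
rewrite mulrDr coordD coordM_fermat4 addr0 (@coordM _ _ _ (- g)).
  by rewrite IH exprSr mulrA.
by rewrite muniN muni_quartic polyCN.
Qed.

(** Multiplication by x acts on each coordinate separately, and B is a domain. *)
Lemma fermat4_regular u : (exists r, u * x = r * f) -> exists r, u = r * f.
Proof.
move=> [r ux]; apply: coord_eq0 => i; have := coordM_fermat4 i r.
rewrite -ux (coordM _ _ (muni_var _)) // => /eqP.
rewrite mulf_eq0 => /orP[/eqP //|/eqP/(congr1 (mcoeff U_(inord 0)))].
by rewrite mcoeffXU eqxx mcoeff0 => /eqP; rewrite oner_eq0.
Qed.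

Lemma fermat4_not_unit : ~ exists r, 1 = r * f.
Proof.
move=> [r e]; have := coordM_fermat4 0 r.
rewrite -e /coord muni1 rmodp_small ?sizeD ?size_poly1 // coefC => /eqP.
by rewrite oner_eq0.
Qed.

(** Needed to conclude that an element avoiding all minimal primes is nonzero in R. *)
Lemma minimal_prime_exists : exists P, minimal_prime_over f P.
Proof.
have [|||P Pmin _] := @minimal_prime_avoiding A f (fun s => s = 1).
- by [].
- by move=> a b -> ->; rewrite mulr1.
- by move=> s ->; apply: fermat4_not_unit.
- by exists P.
Qed.

(* This avoids proving that f is irreducible: x is regular modulo f, so the
   multiplicative set generated by x and the complement of P misses (f). *)
Lemma minimal_prime_vX P : minimal_prime_over f P -> ~ P x.
Proof.
move=> [[[P0 PD PM] P1 Ppr] Pf Pmin] Px.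
have [|||Q [Qpr Qf _] QS] :=
  @minimal_prime_avoiding A f (fun t => exists s n, ~ P s /\ t = s * x ^+ n).
- by exists 1, 0%N; rewrite mulr1.
- move=> a b [s [n [Ps ->]]] [t [m [Pt ->]]]; exists (s * t), (n + m)%N.
  by rewrite exprD mulrACA; split=> // /Ppr[].
- move=> t [s [n [Ps ->]]].
  elim: n => [|n IH]; last by rewrite exprSr mulrA => /fermat4_regular.
  by rewrite mulr1 => -[r sr]; apply: Ps; rewrite sr; apply: PM.
(* [Q] misses the complement of [P], so it lies inside [P] and equals it by minimality; yet [Q]
   misses x as well. *)
apply: (QS x); first by exists 1, 1%N; rewrite mul1r.
apply: (Pmin Q) => // t Qt; apply: boolp.contrapT => Pt.
by apply: (QS t) => //; exists t, 0%N; rewrite mulr1.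
Qed.

Local Notation frob q := (ideal_add (frob_pow (I_gens p) q) (fI p)).

(** The generators x^q, y^q, z^q lie in B and multiples of [f] have zero coordinates, so membership
    descends to B. *)
Lemma coord_frob q u i : frob q u -> frob_span q (coord i u).
Proof.
move=> fu.
have [a [b [c [d ->]]]] : exists a b c d, u = a * x ^+ q + b * y ^+ q + c * z ^+ q + d * f.
  apply: (@ideal_span_min A _ (fun u => exists a b c d,
    u = a * x ^+ q + b * y ^+ q + c * z ^+ q + d * f) _ _ _ fu).
    split.
    - by exists 0, 0, 0, 0; ring.
    - move=> _ _ [a [b [c [d ->]]]] [a' [b' [c' [d' ->]]]].
      by exists (a + a'), (b + b'), (c + c'), (d + d'); ring.
    - move=> t _ [a [b [c [d ->]]]].
      by exists (t * a), (t * b), (t * c), (t * d); ring.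
  move=> v [[n [a [s [Ss ->]]]]|[n [a [s [Ss ->]]]]].
    elim: n a s Ss => [|n IH] a s Ss.
      by exists 0, 0, 0, 0; rewrite big_ord0; ring.
    have [|a0 [b0 [c0 [d0 e0]]]] := IH (fun i => a (lift ord0 i)) (fun i => s (lift ord0 i)).
      by move=> j; apply: Ss.
    rewrite big_ord_recl e0; have := Ss ord0; rewrite !inE.
    case/or3P => /eqP->.
    - by exists (a ord0 + a0), b0, c0, d0; ring.
    - by exists a0, (a ord0 + b0), c0, d0; ring.
    - by exists a0, b0, (a ord0 + c0), d0; ring.
  exists 0, 0, 0, (\sum_(j < n) a j); rewrite !mul0r !add0r mulr_suml.
  by apply: eq_bigr => j _; have := Ss j; rewrite inE => /eqP->.
rewrite !coordD coordM_fermat4 addr0.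
exists (coord i a), (coord i b), (coord i c).
have coordX u0 j : (j < 3)%N -> coord i (u0 * 'X_(inord j) ^+ q) = coord i u0 * var j ^+ q.
  by move=> j3; apply: coordM; rewrite rmorphXn /= muni_var // polyC_exp.
by congr (_ + _ + _); apply: coordX.
Qed.

Lemma frob_ideal q : is_ideal (frob q).
Proof. exact: ideal_span_ideal. Qed.

(** In R the power w^(4n) is (-g)^n, and the sign is a unit. *)
Lemma frob_span_coord q n c i :
  frob q (c * w ^+ (4 * n)) -> frob_span q (coord i c * g ^+ n).
Proof.
move/(coord_frob i); rewrite coordMW => -[a0 [b0 [c0 e]]].
exists ((-1) ^+ n * a0), ((-1) ^+ n * b0), ((-1) ^+ n * c0).
have -> : coord i c * g ^+ n = (-1) ^+ n * (coord i c * (- g) ^+ n).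
  by rewrite [(- g) ^+ n]exprNn [coord i c * (_ * _)]mulrCA signrMK.
by rewrite e; ring.
Qed.

End Quartic.

(** * Multinomial coefficients prime to p *)

Lemma prime_ndvd_fact p n : prime p -> (n < p)%N -> ~~ (p %| n`!)%N.
Proof.
move=> pp; elim: n => [|n IH] np; first by rewrite Euclid_dvd1.
by rewrite factS Euclid_dvdM // negb_or gtnNdvd // IH // ltnW.
Qed.

Lemma prime_ndvd_bin p n m : prime p -> (n < p)%N -> (m <= n)%N -> ~~ (p %| 'C(n, m))%N.
Proof.
move=> pp np mn; apply: contra (prime_ndvd_fact pp np) => dvd.
by rewrite -(bin_fact mn) dvdn_mulr.
Qed.

(* One base-p digit of (q - 1) / 2 leaves room for a, b, c when p >= 7; for p = 5
   two digits are needed, with 12 = 5 + 5 + 2 and 12! / (5! 5! 2!) = 2 mod 5. *)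
Lemma balanced_exponents p : prime p -> (5 <= p)%N -> exists s M a b c,
  [/\ p ^ s = M.*2.+1, a + b + c = M, ~~ (p %| 'C(M, c) * 'C(M - c, b)),
      4 * a + 3 <= p ^ s & (4 * b + 3 <= p ^ s) && (4 * c + 3 <= p ^ s)]%N.
Proof.
move=> pp p5; have [-> | np5] := eqVneq p 5%N.
  by exists 2%N, 12%N, 5%N, 5%N, 2%N; split=> //; rewrite Euclid_dvdM.
have np6 : p != 6%N by apply: contraTneq pp => ->.
have np9 : p != 9%N by apply: contraTneq pp => ->.
have op : odd p by case/even_prime: pp => // p2; move: p5; rewrite p2.
have ep : p = p./2.*2.+1 by rewrite -[LHS]odd_double_half op.
(* The largest [r] with 4r + 3 <= p. The remaining share p./2 - 2r meets the same bound for odd p >=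
   7 except 9, where it is 2 and 11 > 9. *)
pose r := ((p - 3) %/ 4)%N.
have rE : (4 * r <= p - 3 < 4 * r + 4)%N by rewrite /r; lia.
exists 1%N, p./2, r, r, (p./2 - r - r)%N; rewrite expn1; split=> //; try lia.
by rewrite Euclid_dvdM // negb_or !prime_ndvd_bin //; lia.
Qed.

(** * Multiples of powers of w outside I^[q] *)

Section Escape.
Variable p : nat.
Hypothesis pp : prime p.
Local Notation A := (Pring p).
Local Notation w := (vW p).
Local Notation f := (fermat4 p).
Local Notation frob q := (ideal_add (frob_pow (I_gens p) q) (fI p)).

(** The top digits of the exponent of g form [M]; the lower part [n] may reach about half of p^e. *)
Lemma frob_escape (u : A) s M a b c :
  (~ exists r, u = r * f) -> (a + b + c = M)%N ->
  ~~ (p %| 'C(M, c) * 'C(M - c, b))%N ->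
  (4 * a + 3 <= p ^ s)%N -> (4 * b + 3 <= p ^ s)%N -> (4 * c + 3 <= p ^ s)%N ->
  exists E, forall e n, (E <= e)%N -> (4 * n <= 2 * p ^ e + 4)%N ->
    ~ frob (p ^ (s + e)) (u * w ^+ (4 * (M * p ^ e + n))).
Proof.
move=> /(coord_neq0 (p := p))[i ui] abc Cp ap bp cp.
(* Of the degree allowance 3 p^e, [n] consumes at most 2 p^e + 4; the rest covers the coordinate
   because e < p^e. *)
exists (msize (coord i u) + 4)%N => e n Ee nle /(frob_span_coord i).
rewrite expnD; apply: (frob_span_quartic (p := p)) abc _ ap bp cp => //.
- exact: pchar_Fp.
- have ee := ltn_expl e (prime_gt1 pp).
  rewrite (leq_trans (leq_add (leqnn _) nle)) // addnCA [(3 * _)%N](mulnDl 2 1) mul1n.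
  by rewrite leq_add2l (leq_trans Ee) // ltnW.
- by rewrite -(dvdn_pcharf (pchar_Fp pp)).
Qed.

Lemma frobM q u v : frob q u -> frob q (u * v).
Proof. by move=> fu; rewrite mulrC; case: (@frob_ideal p q) => _ _; apply. Qed.

Lemma frob_escape2 u : p = 2%N -> (~ exists r, u = r * f) ->
  forall N, exists2 e, (N <= e)%N & ~ frob (p ^ e) (u * w ^+ (0 * p ^ e)).
Proof.
move=> p2 nu N.
(* With all digits zero the bound is 3 <= p^s, first met by s = 2. *)
have [|||||E H] := @frob_escape u 2 0 0 0 0 nu; rewrite ?p2 //.
exists (2 + (E + N))%N; first by lia.
rewrite mul0n => fr; apply: (H (E + N)%N 0%N) => //; lia.
Qed.

Lemma frob_escape3 u : p = 3%N -> (~ exists r, u = r * f) ->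
  forall N, exists2 e, (N <= e)%N & ~ frob (p ^ e) (u * w ^+ (1 * p ^ e)).
Proof.
move=> p3 nu N.
(* Here M = 2 = 1 + 1 + 0, and 4 + 3 <= p^s requires s = 2. *)
have [|||||E H] := @frob_escape u 2 2 1 1 0 nu; rewrite ?p3 //.
(* An even exponent gives p^e = 1 mod 4, so after a factor w^3 the exponent 9 p^e + 3 is divisible
   by 4. *)
pose e := (E + N).*2.
have e4 : (p ^ e = 1 %[mod 4])%N.
  by rewrite p3 /e -muln2 mulnC expnM -modnXm (_ : 3 ^ 2 %% 4 = 1)%N // exp1n.
exists (2 + e)%N; first by lia.
move=> /(frobM (w ^+ 3)); rewrite -mulrA -exprD.
have -> : (1 * p ^ (2 + e) + 3 = 4 * (2 * p ^ e + (p ^ e + 3) %/ 4))%N.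
  by rewrite expnD {1}p3; lia.
by apply: H; lia.
Qed.

Lemma frob_escape_ge5 u : (5 <= p)%N -> (~ exists r, u = r * f) ->
  forall N, exists2 e, (N <= e)%N & ~ frob (p ^ e) (u * w ^+ (2 * p ^ e)).
Proof.
move=> p5 nu N.
have [s [M [a [b [c [ps abc Cp ap /andP[bp cp]]]]]]] := balanced_exponents pp p5.
have [E H] := frob_escape nu abc Cp ap bp cp.
have op : odd (p ^ (E + N)).
  rewrite oddX; case/even_prime: pp => [p2|->]; last by rewrite orbT.
  by move: p5; rewrite p2.
exists (s + (E + N))%N; first by lia.
(* With Q = p^(E+N) and q = (2M + 1) Q, the exponent 2q + 2 equals 4 (M Q + (Q + 1) / 2), where Q is
   odd. *)
move=> /(frobM (w ^+ 2)) fr.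
apply: (H (E + N)%N ((p ^ (E + N) + 1) %/ 2)%N); try lia.
move: fr; rewrite -mulrA -exprD expnD ps.
by have -> : (2 * (M.*2.+1 * p ^ (E + N)) + 2 =
  4 * (M * p ^ (E + N) + (p ^ (E + N) + 1) %/ 2))%N by nia.
Qed.

End Escape.

(** * Comparison of the tight closure with I + (w^k) *)

Section TightClosure.
Variable p : nat.
Hypothesis pp : prime p.
Local Notation A := (Pring p).
Local Notation x := (vX p).
Local Notation y := (vY p).
Local Notation z := (vZ p).
Local Notation w := (vW p).
Local Notation f := (fermat4 p).
Local Notation frob q := (ideal_add (frob_pow (I_gens p) q) (fI p)).

Lemma frobD e (u v : A) : (u + v) ^+ (p ^ e) = u ^+ (p ^ e) + v ^+ (p ^ e).
Proof. exact: (exprD_pcharX e u v (pchar_Pring pp)). Qed.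

Lemma IA_vX : IA p x. Proof. by apply: mem_ideal_span; rewrite inE eqxx. Qed.
Lemma IA_vY : IA p y. Proof. by apply: mem_ideal_span; rewrite !inE eqxx orbT. Qed.
Lemma IA_vZ : IA p z. Proof. by apply: mem_ideal_span; rewrite !inE eqxx !orbT. Qed.

Lemma IA_ideal : is_ideal (IA p).
Proof. exact: ideal_span_ideal. Qed.

Lemma frob_IA e u : IA p u -> frob (p ^ e) (u ^+ (p ^ e)).
Proof.
apply: (@ideal_span_min A _ (fun u => frob (p ^ e) (u ^+ (p ^ e)))).
  exact: (@frob_preim_ideal A (frob (p ^ e)) p e (pchar_Pring pp) (@frob_ideal p (p ^ e))).
move=> v vI; apply: mem_ideal_span; left; apply: mem_ideal_span.
exact: (map_f (fun g : A => g ^+ (p ^ e)) vI).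
Qed.

(** For k <= 4 this ideal already contains [f], so it is the preimage in the polynomial ring of I +
    (w^k) in R. *)
Definition IW (k : nat) (u : A) := exists i r, IA p i /\ u = i + r * w ^+ k.

Lemma IW_ideal k : is_ideal (IW k).
Proof.
have [I0 ID IM] := IA_ideal; split.
- by exists 0, 0; rewrite mul0r addr0.
- move=> _ _ [i [r [Ii ->]]] [j [s [Ij ->]]]; exists (i + j), (r + s).
  by rewrite mulrDl addrACA; split=> //; apply: ID.
- move=> a _ [i [r [Ii ->]]]; exists (a * i), (a * r).
  by rewrite mulrDr mulrA; split=> //; apply: IM.
Qed.

Lemma IA_IW k u : IA p u -> IW k u.
Proof. by move=> Iu; exists u, 0; rewrite mul0r addr0. Qed.

Lemma IW_vW k : IW k (w ^+ k).
Proof. by exists 0, 1; rewrite mul1r add0r; split=> //; case: IA_ideal. Qed.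

Lemma IW_M k u v : IW k u -> IW 1 v -> IW k.+1 (u * v).
Proof.
have [I0 ID IM] := IA_ideal.
move=> [i [r [Ii ->]]] [j [s [Ij ->]]].
exists ((j + s * w) * i + r * w ^+ k * j), (r * s); split; last by rewrite (exprSr _ k); ring.
by apply: (ID); apply: (IM).
Qed.

Lemma mA_IW u : mA p u -> IW 1 u.
Proof.
apply: ideal_span_min; first exact: IW_ideal.
move=> v; rewrite !inE => /or4P[] /eqP->; last exact: (IW_vW 1);
  apply: IA_IW; [exact: IA_vX | exact: IA_vY | exact: IA_vZ].
Qed.

Lemma mA_pow_IW k u : ideal_pow (mA p) k u -> IW k u.
Proof.
elim: k u => [|k IH] u /= mu.
  by exists 0, u; rewrite add0r mulr1; split=> //; case: IA_ideal.
apply: ideal_span_min mu; first exact: IW_ideal.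
by move=> _ [a [b [/IH ka [/mA_IW kb ->]]]]; apply: IW_M.
Qed.

Lemma vW_mA_pow k : ideal_pow (mA p) k (w ^+ k).
Proof.
elim: k => [//|k IH] /=; apply: mem_ideal_span; exists (w ^+ k), w.
rewrite -exprSr; split=> //; split=> //; apply: mem_ideal_span.
by rewrite !inE eqxx !orbT.
Qed.

Lemma IW_fermat4 k u : (k <= 4)%N -> fI p u -> IW k u.
Proof.
move=> k4; have [J0 JD JM] := IW_ideal k; have [I0 ID IM] := IA_ideal.
apply: ideal_span_min; first exact: IW_ideal.
move=> v; rewrite inE => /eqP->.
exists (x ^+ 4 + y ^+ 4 + z ^+ 4), (w ^+ (4 - k)); split; last by rewrite -exprD subnK.
have I4 v0 : IA p v0 -> IA p (v0 ^+ 4) by rewrite exprS mulrC; apply: IM.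
by apply: (ID); [apply: (ID)|]; apply: I4; [exact: IA_vX | exact: IA_vY | exact: IA_vZ].
Qed.

Lemma IW_mA_pow k u : (k <= 4)%N ->
  IW k u <-> ideal_add (ideal_add (IA p) (ideal_pow (mA p) k)) (fI p) u.
Proof.
move=> k4; split.
  move=> [i [r [Ii ->]]]; apply: mem_ideal_span; left.
  have [_ SD SM] := @ideal_span_ideal A (fun v => IA p v \/ ideal_pow (mA p) k v).
  apply: SD; first by apply: mem_ideal_span; left.
  by apply: SM; apply: mem_ideal_span; right; apply: vW_mA_pow.
apply: ideal_span_min; first exact: IW_ideal.
move=> v [|]; last exact: IW_fermat4.
apply: ideal_span_min; first exact: IW_ideal.
by move=> {}v [/IA_IW|/mA_pow_IW].
Qed.

Lemma IW_mA u : IW 1 u <-> ideal_add (mA p) (fI p) u.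
Proof.
have [_ SD SM] := @ideal_span_ideal A (fun v => mA p v \/ fI p v).
split.
  move=> [i [r [Ii ->]]]; apply: SD.
    apply: mem_ideal_span; left; apply: ideal_span_min Ii; first exact: ideal_span_ideal.
    by move=> v vI; apply: mem_ideal_span; move: vI; rewrite !inE => /or3P[]->; rewrite ?orbT.
  by apply: SM; apply: mem_ideal_span; left; apply: mem_ideal_span; rewrite !inE eqxx !orbT.
apply: ideal_span_min; first exact: IW_ideal.
by move=> v [/mA_IW|/IW_fermat4]//; apply.
Qed.

(** Modulo I the ring is F_p[w]; this splits off the constant term there. *)
Lemma constant_term u : exists (a : 'F_p) i s, IA p i /\ u = i + (a%:MP + s * w).
Proof.
have [I0 ID IM] := IA_ideal.
elim/mpoly_ring_ind: u => [c|j|u v [a [i [s [Ii ->]]]] [b [j [t [Ij ->]]]]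
  |u v [a [i [s [Ii ->]]]] [b [j [t [Ij ->]]]]].
- by exists c, 0, 0; rewrite mul0r addr0 add0r.
- have [Ij|->] : IA p 'X_j \/ 'X_j = w.
    have -> : j = inord j by rewrite inord_val.
    case: j => -[|[|[|[|//]]]] jl /=; [left|left|left|by right].
    + exact: IA_vX.
    + exact: IA_vY.
    + exact: IA_vZ.
    + by exists 0, 'X_j, 0; rewrite mul0r mpolyC0 !addr0.
  by exists 0, 0, 1; rewrite mul1r mpolyC0 !add0r.
- exists (a + b), (i + j), (s + t); split; first exact: ID.
  by rewrite mpolyCD; ring.
- exists (a * b), ((j + (b%:MP + t * w)) * i + (a%:MP + s * w) * j),
    (a%:MP * t + s * b%:MP + s * t * w).
  split; first by apply: (ID); apply: (IM).
  by rewrite mpolyCM; ring.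
Qed.

(** Outside [IW k], [u] has a w-adic order j < k modulo I, with an invertible scalar as leading
    coefficient. *)
Lemma IW_or k u : IW k u \/ exists j (a : 'F_p) s i,
  [/\ (j < k)%N, a != 0, IA p i & u = i + (a%:MP + s * w) * w ^+ j].
Proof.
have [I0 ID IM] := IA_ideal.
elim: k => [|k [[i [r [Ii ->]]]|[j [a [s [i [jk a0 Ii ->]]]]]]].
- by left; exists 0, u; rewrite add0r mulr1.
- have [a [i' [s [Ii' ->]]]] := constant_term r.
  have I' : IA p (i + w ^+ k * i') by apply: (ID) => //; apply: IM.
  have [->|a0] := eqVneq a 0.
    left; exists (i + w ^+ k * i'), s; split=> //.
    by rewrite mpolyC0 exprS; ring.
  right; exists k, a, s, (i + w ^+ k * i'); split=> //.
  by ring.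
- by right; exists j, a, s, i; split=> //; apply: ltnW.
Qed.

(** [c0] is a single multiplier witnessing that w^k is in the closure. Its regularity keeps [c * c0]
    nonzero in R, so that [escape] applies to this product. *)
Lemma IstarP k (c0 : A) : (0 < k)%N ->
  (forall u, (exists r, u * c0 = r * f) -> exists r, u = r * f) ->
  (forall P, minimal_prime_over f P -> ~ P c0) ->
  (exists N, forall e, (N <= e)%N -> frob (p ^ e) (c0 * w ^+ (k * p ^ e))) ->
  (forall u, (~ exists r, u = r * f) ->
     forall N, exists2 e, (N <= e)%N & ~ frob (p ^ e) (u * w ^+ (k.-1 * p ^ e))) ->
  forall u, Istar p u <-> IW k u.
Proof.
move=> k0 c0reg c0P [N0 c0w] escape u.
split; last first.
  move=> [i [r [Ii ->]]]; exists c0; split=> //; exists N0 => e Ne.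
  have [F0 FD FM] := @frob_ideal p (p ^ e).
  rewrite frobD mulrDr exprMn mulrCA -exprM.
  by apply: (FD); apply: (FM); [exact: frob_IA | exact: c0w].
move=> [c [cP [N cu]]].
have [//|[j [a [s [i [jk a0 Ii e_u]]]]]] := IW_or k u.
have cf : ~ exists r, c * c0 = r * f.
  move=> /c0reg[r cr]; have [P Pmin] := minimal_prime_exists p.
  apply: (cP P) => //; rewrite cr; case: Pmin => -[[_ _ PM] _ _] Pf _.
  exact: PM.
have [e Ne []] := escape _ cf (N + N0)%N.
have [F0 FD FM] := @frob_ideal p (p ^ e).
(* The factor w^(k-1-j) moves the leading term of [u] modulo I to degree k - 1 in w. *)
have ekey : a%:MP * w ^+ k.-1 + (w ^+ (k.-1 - j) * i + s * w ^+ k) = w ^+ (k.-1 - j) * u :> A.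
  have dj : (k.-1 - j + j)%N = k.-1 by lia.
  have ek : w ^+ k.-1 = w ^+ (k.-1 - j) * w ^+ j by rewrite -[in LHS]dj exprD.
  have -> : w ^+ k = w * w ^+ k.-1 by rewrite -[in LHS](prednK k0) exprS.
  rewrite ek e_u; move: (w ^+ (k.-1 - j)) (w ^+ j) => d' wj.
  by ring.
have := congr1 (fun v => v ^+ (p ^ e)) ekey.
rewrite /= !frobD !exprMn -[(w ^+ k.-1) ^+ _]exprM -[(w ^+ k) ^+ _]exprM.
have : a^-1%:MP ^+ (p ^ e) * a%:MP ^+ (p ^ e) = 1 :> A.
  by rewrite -exprMn -mpolyCM mulVf // expr1n.
have := frob_IA e Ii; have := cu e (leq_trans (leq_addr _ _) Ne).
have := c0w e (leq_trans (leq_addl _ _) Ne).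
move: (a^-1%:MP ^+ _) (a%:MP ^+ _) (w ^+ (k * _)) (w ^+ (k.-1 * _)) ((w ^+ _) ^+ _) (i ^+ _) (s ^+ _) (u ^+ _).
move=> b b' Wk P W1 I S U c0Wk cU fI bb' e1.
(* [b] inverts the q-th power of [a], so the q-th power of [ekey] can be solved for w^((k-1)q); all
   remaining terms lie in I^[q] + (f). *)
have -> : c * c0 * P = b * c0 * W1 * (c * U) + ((- (b * c * c0 * W1)) * I + (- (b * c * S)) * (c0 * Wk)).
  rewrite -[P]mul1r -bb' -[b * b' * P]mulrA; move/(canRL (addrK _)): e1 => ->.
  by ring.
by apply: (FD); [|apply: (FD)]; apply: (FM).
Qed.

Lemma vW4 : w ^+ 4 = (-1) * (x ^+ 4 + y ^+ 4 + z ^+ 4) + f.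
Proof. by rewrite /fermat4; ring. Qed.

Lemma frob_vXYZ q n v : (q <= n)%N -> v \in I_gens p -> frob q (v ^+ n).
Proof.
move=> qn vI; rewrite -(subnK qn) exprD; have [_ _ FM] := @frob_ideal p q.
apply: FM; apply: mem_ideal_span; left; apply: mem_ideal_span.
exact: (map_f (fun v0 : A => v0 ^+ q) vI).
Qed.

Lemma frob_fermat4 q v : frob q (v * f).
Proof.
have [_ _ FM] := @frob_ideal p q; apply: FM.
by apply: mem_ideal_span; right; apply: mem_ideal_span; rewrite inE.
Qed.

(** The p^t-th power of the relation for w^4 is taken termwise, and each x^(4 p^t) is then a
    multiple of x^(p^e). *)
Lemma frob_vW4X e t : (p ^ e <= 4 * p ^ t)%N -> frob (p ^ e) (w ^+ (4 * p ^ t)).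
Proof.
move=> et; have [_ FD FM] := @frob_ideal p (p ^ e).
have fX : frob (p ^ e) (f ^+ (p ^ t)).
  rewrite -(prednK (_ : 0 < p ^ t)%N) ?expn_gt0 ?prime_gt0 // exprSr.
  exact: frob_fermat4.
have vX v : v \in I_gens p -> frob (p ^ e) ((v ^+ 4) ^+ (p ^ t)).
  by rewrite -exprM; apply: frob_vXYZ.
rewrite exprM vW4 frobD; apply: (FD) fX; rewrite exprMn; apply: FM.
rewrite (frobD t (x ^+ 4 + y ^+ 4)) (frobD t (x ^+ 4)).
by apply: (FD); [apply: (FD)|]; apply: vX; rewrite !inE eqxx ?orbT.
Qed.

(* The pigeonhole on exponents: a monomial of degree at least 3q - 2 in x, y, z
   is divisible by x^q, y^q or z^q. *)
Lemma frob_monomial q n i j k : (3 * q <= i + j + k + 4 * n + 2)%N ->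
  frob q (x ^+ i * y ^+ j * z ^+ k * w ^+ (4 * n)).
Proof.
have [_ FD FM] := @frob_ideal p q.
elim: n i j k => [|n IH] i j k le_q.
  rewrite mulr1; have [qi|iq] := leqP q i.
    by rewrite -mulrA mulrC; apply: FM; apply: frob_vXYZ; rewrite // !inE eqxx.
  have [qj|jq] := leqP q j.
    by rewrite mulrAC; apply: FM; apply: frob_vXYZ; rewrite // !inE eqxx ?orbT.
  by apply: FM; apply: frob_vXYZ; rewrite // ?inE ?eqxx ?orbT //; lia.
have -> : x ^+ i * y ^+ j * z ^+ k * w ^+ (4 * n.+1) =
    (-1) * (x ^+ (i + 4) * y ^+ j * z ^+ k * w ^+ (4 * n)
          + x ^+ i * y ^+ (j + 4) * z ^+ k * w ^+ (4 * n)
          + x ^+ i * y ^+ j * z ^+ (k + 4) * w ^+ (4 * n))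
    + x ^+ i * y ^+ j * z ^+ k * w ^+ (4 * n) * f.
  by rewrite mulnS exprD vW4 !exprD; ring.
apply: (FD); last exact: frob_fermat4.
by apply: (FM); apply: (FD); [apply: (FD)|]; apply: IH; lia.
Qed.

(** Rounding 3q down to a multiple of 4 loses at most 3; the factor x restores one, which reaches
    the degree 3q - 2. *)
Lemma frob_vX_vW3 q : frob q (x * w ^+ (3 * q)).
Proof.
have [_ _ FM] := @frob_ideal p q.
rewrite (divn_eq (3 * q) 4) exprD mulnC mulrA mulrC; apply: FM.
have := @frob_monomial q (3 * q %/ 4) 1 0 0.
by rewrite !mulr1; apply; lia.
Qed.

Lemma Istar_IW k :
  [\/ p = 2%N /\ k = 1%N, p = 3%N /\ k = 2%N | (5 <= p)%N /\ k = 3%N] ->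
  forall u, Istar p u <-> IW k u.
Proof.
have reg1 u : (exists r, u * 1 = r * f) -> exists r, u = r * f by rewrite mulr1.
have P1 P : minimal_prime_over f P -> ~ P 1 by move=> [[]].
case=> [[p2 ->]|[p3 ->]|[p5 ->]].
- apply: (@IstarP _ 1) => //; last by move=> u nu N; apply: frob_escape2.
  exists 2%N => e e2; rewrite mul1r mul1n.
  have pe : (p ^ e = 4 * p ^ (e - 2))%N by rewrite -{1}(subnKC e2) expnD {1}p2.
  by rewrite [in X in w ^+ X]pe; apply: frob_vW4X; rewrite pe.
- apply: (@IstarP _ 1) => //; last by move=> u nu N; apply: frob_escape3.
  exists 1%N => e e1; rewrite mul1r.
  have pe : (p ^ e = 3 * p ^ e.-1)%N by rewrite -{1}(prednK e1) expnS {1}p3.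
  (* The factor w^(4 p^(e-1)) suffices, since 4 p^(e-1) exceeds q = 3 p^(e-1). *)
  have -> : (2 * p ^ e = 2 * p ^ e.-1 + 4 * p ^ e.-1)%N by rewrite pe; lia.
  by rewrite exprD; case: (@frob_ideal p (p ^ e)) => _ _; apply; apply: frob_vW4X; lia.
- apply: (@IstarP _ x) => //.
  + exact: fermat4_regular.
  + exact: minimal_prime_vX.
  + by exists 0%N => e _; apply: frob_vX_vW3.
  + by move=> u nu N; apply: frob_escape_ge5.
Qed.

End TightClosure.

Local Close Scope ring_scope.

Theorem theorem6p1 (p : nat) (pp : prime p) :
  [/\ p = 2 -> forall u : Pring p,
        Istar p u <-> ideal_add (mA p) (fI p) u,
      p = 3 -> forall u : Pring p,
        Istar p u <-> ideal_add (ideal_add (IA p) (ideal_pow (mA p) 2)) (fI p) u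
    & (5 <= p)%N -> forall u : Pring p,
        Istar p u <-> ideal_add (ideal_add (IA p) (ideal_pow (mA p) 3)) (fI p) u].
Proof.
split=> hp u.
- by rewrite -IW_mA; apply: Istar_IW => //; constructor 1.
- by rewrite -IW_mA_pow //; apply: Istar_IW => //; constructor 2.
- by rewrite -IW_mA_pow //; apply: Istar_IW => //; constructor 3.
Qed.
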